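(* Let $\mathbb{K}$ be a field of characteristic $0$, let $x\in\mathbb{K}$, let $(\mathfrak{g}_{\mathcal D},\circ)$ be the left pre-Lie algebra of dissection diagrams with parameter $x$, and let $a$ be the unique dissection diagram of degree $1$. Then the pre-Lie subalgebra of $\mathfrak{g}_{\mathcal D}$ generated by $a$ is a non-trivial (i.e. nonzero and strict) pre-Lie subalgebra of $\mathfrak{g}_{\mathcal D}$.
   Context: A left pre-Lie algebra is a vector space $\mathfrak g$ with a bilinear product $\circ$ such that $u\circ(v\circ w)-(u\circ v)\circ w=v\circ(u\circ w)-(v\circ u)\circ w$. Dissection diagrams. For $n\ge 0$ let $\Pi_n$ be the regular $(n+1)$-gon with vertices $0,1,\dots,n$ numbered clockwise; vertex $0$ is the root. For $0\le i\le n$, side $i$ goes from vertex $i$ to vertex $i+1$ (with $n+1$ read as $0$). A chord is a segment joining two distinct vertices (adjacent vertices are allowed; such a chord is distinct from the side). A dissection diagram of degree $n$ is a set of $n$ pairwise non-crossing chords (they may share endpoints) of $\Pi_n$ forming an acyclic graph, hence a spanning tree on $\{0,\dots,n\}$. All chords are oriented towards the root. $\mathrm{Ch}(D)$ is the set of chords of $D$. The diagram of degree $0$ is identified with $1$. Coproduct. $\mathcal H_D$ is the commutative polynomial algebra on dissection diagrams of positive degree, with $\Delta(D)=\sum_{C\subset \mathrm{Ch}(D)}x^{k_C(D)}q_C(D)\otimes r_C(D)$ (with $x^0=1$), extended multiplicatively; it is a graded connected Hopf algebra. Here the $p=|C|$ chords of $C$ cut the polygon into $p+1$ faces; for a face $\alpha$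 let $S_C(\alpha)$ be the (nonempty) set of sides of the polygon bordering $\alpha$. $q_C(D)$ is obtained by contracting every chord of $C$ to a point: each face $\alpha$ becomes a polygon with set of sides $S_C(\alpha)$, rooted at the starting vertex of its side of minimal label, carrying the chords of $D$ not in $C$ that lie in $\alpha$; this is a dissection diagram, and $q_C(D)$ is the product of these over all faces. $r_C(D)$ is the dissection diagram of degree $p$ obtained by keeping the chords of $C$ and contracting all sides which are not the minimal side of their face, the root being the image of $0$. $k_C(D)$ is the number of chords of $C$ whose orientation in $D$ is opposite to their orientation (towards the root) in $r_C(D)$. $\mathfrak g_{\mathcal D}$ is the vector space with basis the dissection diagrams of positive degree, with product $D_1\circ D_2=\sum_D c(D_1,D_2;D)\,D$, where $c(D_1,D_2;D)$ is the coefficient of $D_1\otimes D_2$ in $\Delta(D)$ and $D$ runs over dissection diagrams; it is a left pre-Lie algebra. *)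

(* Defs.v *)
From HB Require Import structures.
From mathcomp Require Import all_boot all_order all_algebra.
From mathcomp Require Import finmap monalg.

Set Implicit Arguments.
Unset Strict Implicit.
Unset Printing Implicit Defensive.

Import GRing.Theory.
Local Open Scope ring_scope.

(* The vertices of Pi_n are the elements of 'I_n.+1.  So are its sides: side i
   goes from vertex i to vertex i + 1, side n going back to vertex 0.  A chord
   is encoded by the pair (u, v) of its ends with u < v; [link u v] is the
   chord with ends u and v in either order. *)
Definition chord (n : nat) : Type := ('I_n.+1 * 'I_n.+1)%type.

Definition link n (u v : 'I_n.+1) : chord n :=
  if (u <= v)%N then (u, v) else (v, u).

Definition crossing n (c d : chord n) : bool :=
  [&& (c.1 < d.1)%N, (d.1 < c.2)%N & (c.2 < d.2)%N].

Definition adj n (E : {set chord n}) : rel 'I_n.+1 :=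
  [rel u v | link u v \in E].

(* A cycle has pairwise distinct vertices, hence at most n + 1 of them. *)
Definition acyclic n (E : {set chord n}) : bool :=
  [forall k : 'I_n.+2, forall t : k.-tuple 'I_n.+1,
    (2 < k)%N ==> ~~ (cycle (adj E) t && uniq t)].

Definition is_dissection n (E : {set chord n}) : bool :=
  [&& [forall c in E, (c.1 < c.2)%N],
      [forall c in E, forall d in E, ~~ crossing c d],
      acyclic E & #|E| == n].

Record diagram (n : nat) : predArgType := Diagram {
  chords :> {set chord n};
  _ : is_dissection chords }.

HB.instance Definition _ n := [isSub for @chords n].
HB.instance Definition _ n := [Finite of diagram n by <:].

(* Dissection diagrams of positive degree; [existT _ n D] has degree n + 1. *)
Definition pdiagram : Type := {n : nat & diagram n.+1}.

(* In the tree E, the chord with ends u and v is oriented from u to v when it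
   is the first step of the path from u to the root, i.e. when v is still
   joined to the root once that chord is removed. *)
Definition oriented n (E : {set chord n}) (u v : 'I_n.+1) : bool :=
  connect (adj (E :\ link u v)) v ord0.

(* Let u < v <= n + 1.  The chord e cuts the polygon in two, and the segment
   from u to v (a side when v = u + 1, or a chord which does not cross e and
   differs from e) lies in the part opposite to side n iff [under e u v]. *)
Definition under n (e : chord n) (u v : nat) : bool :=
  (e.1 <= u)%N && (v <= e.2)%N.

(* The faces cut out by the chords of C, each given by its set of sides: two
   sides border the same face iff no chord of C separates them. *)
Definition faces n (C : {set chord n}) : {set {set 'I_n.+1}} :=
  preim_partition (fun s : 'I_n.+1 => [set e in C | under e s s.+1])
                  [set: 'I_n.+1].

Definition face_chords n (D C : {set chord n}) (S : {set 'I_n.+1}) :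
    {set chord n} :=
  [set c in D :\: C |
    [forall e in C, forall s in S, under e c.1 c.2 == under e s s.+1]].

Definition min_sides n (C : {set chord n}) : {set 'I_n.+1} :=
  [set s | [exists S in faces C, (s \in S) && [forall t in S, (s <= t)%N]]].

(* Both contractions occurring in the coproduct produce a polygon whose sides
   are those of a given nonempty set S = {s_0 < ... < s_m}, where side s_t
   becomes side t.  The vertices v with s_(t-1) < v <= s_t are merged into
   vertex t, and those beyond s_m are merged with those up to s_0 into the
   root 0; for a face, the merging is restricted to the vertices of the face. *)
Definition contract_vertex n (S : {set 'I_n.+1}) (v : 'I_n.+1) :
    'I_(#|S|.-1).+1 :=
  inord (#|[set s in S | (s < v)%N]| %% #|S|).

Definition contract n (S : {set 'I_n.+1}) (A : {set chord n}) :
    {set chord #|S|.-1} :=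
  [set link (contract_vertex S c.1) (contract_vertex S c.2) | c in A].

Definition r_chords n (C : {set chord n}) : {set chord #|min_sides C|.-1} :=
  contract (min_sides C) C.

Definition k_flips n (D C : {set chord n}) : nat :=
  #|[set c in C | oriented D c.1 c.2 !=
                  oriented (r_chords C)
                    (contract_vertex (min_sides C) c.1)
                    (contract_vertex (min_sides C) c.2)]|.

Notation hopf_alg K := {malg K[{cmonom pdiagram}]}.

(* The tensor square of the polynomial algebra, on its monomial basis. *)
Notation hopf_alg2 K :=
  {malg K[({cmonom pdiagram} * {cmonom pdiagram})%type]}.

(* The underlying vector space of the pre-Lie algebra. *)
Notation preLieD K := {malg K[pdiagram]}.

Definition diagram_monom n : diagram n -> {cmonom pdiagram} :=
  match n with
  | 0 => fun _ => mone
  | m.+1 => fun D => ucm (Tagged (fun i => diagram i.+1) D : pdiagram)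
  end.

Section PreLie.
Variables (K : fieldType) (x : K).

(* The value 0 is never used below: the contractions arising from a dissection
   diagram are dissection diagrams. *)
Definition diagram_elt n (E : {set chord n}) : hopf_alg K :=
  if insub E is Some D then << diagram_monom (D : diagram n) >> else 0.

Definition tens (p q : hopf_alg K) :
    hopf_alg2 K :=
  \sum_(m1 <- msupp p) \sum_(m2 <- msupp q) << p@_m1 * q@_m2 *g (m1, m2) >>.

Definition q_part n (D C : {set chord n}) : hopf_alg K :=
  \prod_(S in faces C) diagram_elt (contract S (face_chords D C S)).

Definition r_part n (C : {set chord n}) : hopf_alg K :=
  diagram_elt (r_chords C).

Definition coproduct n (D : diagram n) :
    hopf_alg2 K :=
  \sum_(C : {set chord n} | C \subset chords D)
     x ^+ k_flips D C *: tens (q_part D C) (r_part C).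

Definition structure_coef (D1 D2 : pdiagram) n (D : diagram n) : K :=
  (coproduct D)@_((ucm D1, ucm D2)).

(* The coproduct being graded, only the diagrams D whose degree is the sum of
   the degrees of D1 and D2 contribute. *)
Definition circ_basis (D1 D2 : pdiagram) : preLieD K :=
  \sum_(D : diagram (tag D1 + (tag D2).+1).+1)
     << structure_coef D1 D2 D *g Tagged (fun i => diagram i.+1) D >>.

Definition circ (u v : preLieD K) : preLieD K :=
  \sum_(D1 <- msupp u) \sum_(D2 <- msupp v)
     (u@_D1 * v@_D2) *: circ_basis D1 D2.

Definition preLie_subalgebra (P : preLieD K -> Prop) : Prop :=
  [/\ P 0,
      forall (k : K) u v, P u -> P v -> P (k *: u + v) &
      forall u v, P u -> P v -> P (circ u v)].

Definition generated (g v : preLieD K) : Prop :=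
  forall P, preLie_subalgebra P -> P g -> P v.

End PreLie.

Fact dissection1 : is_dissection [set (ord0, ord_max) : chord 1].
Proof.
apply/and4P; split.
- by apply/forall_inP => c /set1P ->.
- by apply/forall_inP => c /set1P ->; apply/forall_inP => d /set1P ->.
- apply/forallP => k; apply/forallP => t; apply/implyP => k3.
  apply/negP => /andP[_ /card_uniqP]; rewrite size_tuple => tk.
  by have := max_card [in t]; rewrite tk card_ord leqNgt k3.
- by rewrite cards1.
Qed.

Definition diagram_a : diagram 1 := Diagram dissection1.

Fact diagram_a_unique (D : diagram 1) : D = diagram_a.
Proof.
apply/val_inj; case: D => E /= /and4P[/forall_inP lt _ _ /cards1P[c cE]].
move: (lt c); rewrite cE set11 => /(_ isT) {}lt; congr [set _].
case: c lt {cE} => u v /= uv; congr (_, _); apply/val_inj => /=.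
  by have := ltn_ord v; case: (val u) uv => // m; case: (val v) => [|[|]].
by have := ltn_ord v; case: (val v) uv => [|[|]].
Qed.

Definition elt_a (K : fieldType) : preLieD K :=
  << (Tagged (fun i => diagram i.+1) diagram_a : pdiagram) >>.

(* Main.v *)
Require Import Defs.
From mathcomp Require Import all_boot all_order all_algebra.
From mathcomp Require Import finmap monalg.
Local Open Scope ring_scope.

(** The product of two diagrams is homogeneous: its degree is the sum of their
    degrees.  As [a] is the only diagram of degree 1, the degree 2 part of any
    product [u o v] is therefore a multiple of [a o a].  So the vectors whose
    degree 2 part lies on the line spanned by [a o a] form a pre-Lie subalgebra
    containing [a] ([a_line2_subalgebra], [a_line2_a]), hence containing
    everything that [a] generates.  But there are several diagrams of degree 2,
    for instance [diagram_path] and [diagram_star], and one line cannot contain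
    both of them ([exists_off_a_line2]).  Since [a] itself is nonzero, the
    subalgebra generated by [a] is neither zero nor the whole space. *)

Import GRing.Theory.

Lemma link_inj n (u v u' v' : 'I_n.+1) :
  link u v = link u' v' -> (u = u' /\ v = v') \/ (u = v' /\ v = u').
Proof. by rewrite /link; do 2!case: ifP => _; case=> -> ->; auto. Qed.

(** In a triangle, two chords can neither cross, for want of four vertices, nor
    contain a cycle, which would need three distinct chords. *)
Lemma is_dissection_triangle (E : {set chord 2}) :
  (forall c, c \in E -> (c.1 < c.2)%N) -> #|E| = 2%N -> is_dissection E.
Proof.
move=> ltE cardE; apply/and4P; split; last by rewrite cardE.
- exact/forall_inP.
- apply/forall_inP => c _; apply/forall_inP => d _.
  apply/negP => /and3P[c1 d1 c2].
  by have := leq_trans (leq_ltn_trans (leq_ltn_trans c1 d1) c2) (ltn_ord d.2).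
- apply/forallP => k; apply/forallP => t; apply/implyP => k3.
  apply/negP => /andP[cyc uniq_t].
  have k_eq3 : k = 3%N :> nat.
    by apply/eqP; rewrite eqn_leq k3 andbT -ltnS ltn_ord.
  case: t cyc uniq_t => s /= /eqP; rewrite k_eq3.
  case: s => [|u [|v [|w [|//]]]] //= _ /and4P[uv vw wu _].
  rewrite !inE andbT negb_or => /andP[/andP[uNv uNw] vNw].
  suff : (#|[set link u v; link v w; link w u]| <= #|E|)%N.
    rewrite cardE -setUA cardsU1 cards2 !inE.
    have -> : link u v == link v w = false.
      apply/negP => /eqP/link_inj[][e1 e2]; first by rewrite e1 eqxx in uNv.
      by rewrite e1 eqxx in uNw.
    have -> : link u v == link w u = false.
      apply/negP => /eqP/link_inj[][e1 e2]; first by rewrite e1 eqxx in uNw.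
      by rewrite e2 eqxx in vNw.
    have -> // : link v w == link w u = false.
    apply/negP => /eqP/link_inj[][e1 e2]; first by rewrite e1 eqxx in vNw.
    by rewrite e1 eqxx in uNv.
  apply: subset_leq_card; apply/subsetP => c.
  by rewrite !inE => /orP[/orP[]|] /eqP->.
Qed.

Definition vertex1 : 'I_3 := inord 1.

Fact dissection_path :
  is_dissection ([set (ord0, vertex1); (vertex1, ord_max)] : {set chord 2}).
Proof.
apply: is_dissection_triangle.
  by move=> c /set2P[] ->; rewrite /= inordK.
by rewrite cards2 xpair_eqE -val_eqE /= inordK.
Qed.

Fact dissection_star :
  is_dissection ([set (ord0, vertex1); (ord0, ord_max)] : {set chord 2}).
Proof.
apply: is_dissection_triangle.
  by move=> c /set2P[] ->; rewrite /= ?inordK.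
by rewrite cards2 xpair_eqE -!val_eqE /= inordK.
Qed.

Definition diagram_path : pdiagram :=
  Tagged (fun i => diagram i.+1) (Diagram dissection_path).

Definition diagram_star : pdiagram :=
  Tagged (fun i => diagram i.+1) (Diagram dissection_star).

Lemma diagram_path_neq_star : diagram_path != diagram_star.
Proof.
rewrite eq_Tagged -val_eqE /=; apply/negP => /eqP/setP/(_ (ord0, ord_max)).
by rewrite !inE !xpair_eqE -!val_eqE /= inordK.
Qed.

Definition pdiagram_a : pdiagram := Tagged (fun i => diagram i.+1) diagram_a.

Lemma tag0_pdiagram_a (D : pdiagram) : tag D = 0%N -> D = pdiagram_a.
Proof.
case: D => n D /= n0; move: D; rewrite n0 => D.
by rewrite (diagram_a_unique D).
Qed.

Section Generated.
Variables (K : fieldType) (x : K).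

Lemma generated_subalgebra (g : preLieD K) :
  preLie_subalgebra x (generated x g).
Proof.
split=> [P [] // | k u v gu gv P sP Pg | u v gu gv P sP Pg].
  by case: (sP) => _ lin _; apply: lin; [apply: gu | apply: gv].
by case: (sP) => _ _ mul; apply: mul; [apply: gu | apply: gv].
Qed.

Lemma circ_basis_graded (D1 D2 D : pdiagram) :
  tag D != (tag D1 + (tag D2).+1)%N -> (circ_basis x D1 D2)@_D = 0.
Proof.
move=> degD; rewrite /circ_basis raddf_sum big1 // => E _ /=.
by rewrite mcoeffU; have [ED|//] := eqVneq; rewrite -ED eqxx in degD.
Qed.

(** Tag 1 singles out the diagrams of degree 2: a basis element tagged by [n]
    has degree [n + 1]. *)
Definition a_line2 (v : preLieD K) : Prop :=
  exists k, forall D : pdiagram, tag D = 1%N ->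
    v@_D = k * (circ_basis x pdiagram_a pdiagram_a)@_D.

Lemma a_line2_0 : a_line2 0.
Proof. by exists 0 => D _; rewrite mcoeff0 mul0r. Qed.

Lemma a_line2_lin k u v : a_line2 u -> a_line2 v -> a_line2 (k *: u + v).
Proof.
move=> [a ua] [b vb]; exists (k * a + b) => D D1.
by rewrite mcoeffD mcoeffZ ua // vb // mulrDl mulrA.
Qed.

(** Degree 2 is reached only as 1 + 1, and the only diagram of degree 1 is
    [a]. *)
Lemma a_line2_circ_basis D1 D2 : a_line2 (circ_basis x D1 D2).
Proof.
case: (posnP (tag D1)) => [/tag0_pdiagram_a -> | D1_gt0].
  case: (posnP (tag D2)) => [/tag0_pdiagram_a -> | D2_gt0].
    by exists 1 => D _; rewrite mul1r.
  exists 0 => D D_deg; rewrite mul0r circ_basis_graded // D_deg.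
  by case: (tag D2) D2_gt0.
exists 0 => D D_deg; rewrite mul0r circ_basis_graded // D_deg.
by case: (tag D1) D1_gt0 => // m _; rewrite addSnnS addnC.
Qed.

Lemma a_line2_subalgebra : preLie_subalgebra x a_line2.
Proof.
have addP u v : a_line2 u -> a_line2 v -> a_line2 (u + v).
  by move=> Pu Pv; rewrite -(scale1r u); apply: a_line2_lin.
split=> [|k u v|u v _ _]; first exact: a_line2_0.
  exact: a_line2_lin.
apply: big_ind => // [|D1 _]; first exact: a_line2_0.
apply: big_ind => // [|D2 _]; first exact: a_line2_0.
rewrite -[X in a_line2 X]addr0.
by apply: a_line2_lin; [apply: a_line2_circ_basis | apply: a_line2_0].
Qed.

Lemma a_line2_a : a_line2 (elt_a K).
Proof.
by exists 0 => D D1; rewrite mul0r mcoeffU; case: eqP D1 => // <-.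
Qed.

Lemma generated_a_line2 v : generated x (elt_a K) v -> a_line2 v.
Proof. by apply; [exact: a_line2_subalgebra | exact: a_line2_a]. Qed.

(** If [a o a] has no coefficient on [D1], the basis vector [D1] is off the
    line; otherwise a vector of the line without coefficient on [D1] has no
    degree 2 part, which excludes [D2]. *)
Lemma exists_off_a_line2 (D1 D2 : pdiagram) :
  tag D1 = 1%N -> tag D2 = 1%N -> D1 != D2 ->
  exists v, ~ a_line2 v.
Proof.
move=> deg1 deg2 neq.
have [aa0|aa_neq0] := eqVneq (circ_basis x pdiagram_a pdiagram_a)@_D1 0.
  exists << D1 >> => -[k /(_ _ deg1)/eqP].
  by rewrite aa0 mulr0 mcoeffUU oner_eq0.
exists << D2 >> => -[k k_eq].
have := k_eq _ deg1; rewrite mcoeffU eq_sym (negPf neq) => /esym/eqP.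
rewrite mulf_eq0 (negPf aa_neq0) orbF => /eqP k0.
by have /eqP := k_eq _ deg2; rewrite mcoeffUU k0 mul0r oner_eq0.
Qed.

End Generated.

Theorem lemma28 (K : fieldType) (charK : [pchar K] =i pred0) (x : K) :
  [/\ preLie_subalgebra x (generated x (elt_a K)),
      exists2 v : preLieD K, generated x (elt_a K) v & v != 0 &
      exists v : preLieD K, ~ generated x (elt_a K) v].
Proof.
split; first exact: generated_subalgebra.
  exists (elt_a K); first by move=> P _.
  apply/eqP => /(congr1 (mcoeff pdiagram_a)).
  by rewrite mcoeffUU mcoeff0 => /eqP; rewrite oner_eq0.
have [v off_v] :=
  exists_off_a_line2 K x diagram_path diagram_star erefl erefl
    diagram_path_neq_star.
by exists v => /generated_a_line2.
Qed.
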